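(* Let $\mathcal{B}$ be a $C^*$-algebra, let $E$ be a Hilbert $\mathcal{B}$-module, and let $K$ be a subset of $E$. Consider the two conditions (a) $E\langle E,K\rangle\subset K$, and (b) $K\langle E,E\rangle\subset K$. 1. If $K$ is a closed ternary ideal, then both (a) and (b) hold. 2. Conditions (a) and (b) together imply that the closure $\overline{K}$ is a ternary ideal. 3. On the contrary, neither of the two conditions (a), (b) alone implies that $\overline{K}$ is a ternary ideal.
   Context: Hilbert modules are right modules with $\mathcal{B}$-valued inner product $\langle\cdot,\cdot\rangle$, linear in the second variable. Products of sets are just the sets of products of elements (no linear span or closure is taken), e.g. $E\langle E,K\rangle=\{x\langle y,k\rangle: x,y\in E,\ k\in K\}$. A linear subspace $K$ of a Hilbert $\mathcal{B}$-module $E$ is called a ternary ideal if $E\langle K,E\rangle\subset K$. $\overline{K}$ denotes the norm closure of $K$ in $E$.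
   Formalization: Part 2 is false for arbitrary subsets K (e.g. K empty, or the union of the two axes in C+C), so for all K it is shown only that the closure satisfies the inclusion E<K,E> in K, and that it is a ternary ideal if K is a linear subspace; part 3 is shown with K a linear subspace. *)

(* Defs.v *)
From HB Require Import structures.
From mathcomp Require Import all_boot all_order all_algebra.
From mathcomp Require Import complex.
From mathcomp Require Import all_classical all_reals all_analysis.
Import Order.TTheory GRing.Theory Num.Theory.
Import numFieldNormedType.Exports.

Set Implicit Arguments.
Unset Strict Implicit.
Unset Printing Implicit Defensive.

Local Open Scope classical_set_scope.
Local Open Scope ring_scope.
Local Open Scope complex_scope.

(* Norms of normedModType R[i] take their values in R[i] (as nonnegative
   reals).  C*-algebras need not be unital, so the ring structures of MathComp
   do not apply and the product is part of this mixin. *)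
HB.mixin Record CompleteNormedModule_isCStarAlgebra (R : realType) B
    of CompleteNormedModule R[i] B := {
  cmul : B -> B -> B;
  cstar : B -> B;
  cmulA : associative cmul;
  cmul_linearl : forall (a : R[i]) (x y z : B),
    cmul (a *: x + y) z = a *: cmul x z + cmul y z;
  cmul_linearr : forall (a : R[i]) (x y z : B),
    cmul x (a *: y + z) = a *: cmul x y + cmul x z;
  cstar_antilinear : forall (a : R[i]) (x y : B),
    cstar (a *: x + y) = Num.conj a *: cstar x + cstar y;
  cstarK : involutive cstar;
  cstarM : forall x y : B, cstar (cmul x y) = cmul (cstar y) (cstar x);
  cnormM : forall x y : B, `|cmul x y| <= `|x| * `|y|;
  cnorm_starM : forall x : B, `|cmul (cstar x) x| = `|x| ^+ 2
}.

#[short(type="cstarAlgType")]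
HB.structure Definition CStarAlgebra (R : realType) :=
  { B of CompleteNormedModule_isCStarAlgebra R B & CompleteNormedModule R[i] B }.

Definition cpositive (R : realType) (B : cstarAlgType R) (a : B) : Prop :=
  exists b : B, a = cmul (cstar b) b.

HB.mixin Record CompleteNormedModule_isHilbertModule (R : realType)
    (B : cstarAlgType R) E of CompleteNormedModule R[i] E := {
  ract : E -> B -> E;
  inner : E -> E -> B;
  ract_linearl : forall (a : R[i]) (x y : E) (b : B),
    ract (a *: x + y) b = a *: ract x b + ract y b;
  ract_linearr : forall (a : R[i]) (x : E) (b c : B),
    ract x (a *: b + c) = a *: ract x b + ract x c;
  ractA : forall (x : E) (b c : B), ract (ract x b) c = ract x (cmul b c);
  inner_linearr : forall (a : R[i]) (x y z : E),
    inner x (a *: y + z) = a *: inner x y + inner x z;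
  inner_ractr : forall (x y : E) (b : B),
    inner x (ract y b) = cmul (inner x y) b;
  inner_star : forall x y : E, cstar (inner x y) = inner y x;
  inner_pos : forall x : E, cpositive (inner x x);
  inner_definite : forall x : E, inner x x = 0 -> x = 0;
  norm_inner : forall x : E, `|x| ^+ 2 = `|inner x x|
}.

#[short(type="hilbertModType")]
HB.structure Definition HilbertModule (R : realType) (B : cstarAlgType R) :=
  { E of CompleteNormedModule_isHilbertModule R B E
       & CompleteNormedModule R[i] E }.

Section TernaryIdeals.
Variables (R : realType) (B : cstarAlgType R) (E : hilbertModType B).
Implicit Types X Y Z K : set E.

(* X<Y, Z>, a plain set of products: no linear span or closure is taken. *)
Definition ternary_product X Y Z : set E :=
  [set u | exists x y z, [/\ X x, Y y, Z z & u = ract x (inner y z)]].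

Definition linear_subspace K : Prop := submod_closed (mem K).

Definition ternary_ideal K : Prop :=
  linear_subspace K /\ ternary_product setT K setT `<=` K.

Definition condition_a K : Prop := ternary_product setT setT K `<=` K.

Definition condition_b K : Prop := ternary_product K setT setT `<=` K.

End TernaryIdeals.

(* Main.v *)
Require Import Defs.
From HB Require Import structures.
From mathcomp Require Import all_boot all_order all_algebra.
From mathcomp Require Import sesquilinear spectral complex ring lra.
From mathcomp Require Import all_classical all_reals all_analysis.
Import Order.TTheory GRing.Theory Num.Theory.
Import numFieldNormedType.Exports.

Set Implicit Arguments.
Unset Strict Implicit.
Unset Printing Implicit Defensive.

Local Open Scope classical_set_scope.
Local Open Scope ring_scope.
Local Open Scope complex_scope.
Local Open Scope sesquilinear_scope.

(* Every k in E is a limit of elements k<k, e>.  Indeed T e = k<k, e> is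
   self-adjoint, so (T + i eps) e = k can be solved (here: up to an arbitrarily
   small error), and taking "real and imaginary parts" of <e, k> shows that
   |<k, e>| stays bounded and eps |e| tends to 0 with eps.
   Hence k<x, y> is a limit of elements k<k, e><x, y> = k<k, e<x, y>>, and
   x<y, k> of x<y, k<k, e>> = (x<y, k>)<k, e>; both lie in E<K, E>.
   Likewise x<k, y> is a limit of elements x<k<k, e>, y> = (x<e, k>)<k, y>,
   which lie in K by (a), then (b).
   The counterexamples are a left and a right ideal of E = B = M_2. *)

(** * Real-valued norms and closures *)

(** Norms lie in [R[i]], whose order is only partial; in [R] the order is total and [lra] and [nra]
    apply. *)
Definition rnorm (R : realType) (V : normedModType R[i]) (x : V) : R :=
  complex.Re `|x|.

Section RealNorm.
Variables (R : realType) (V : normedModType R[i]).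
Implicit Types x y : V.

Lemma rnormE x : `|x| = (rnorm x)%:C.
Proof. exact: esym (RRe_real (normr_real x)). Qed.

Lemma rnorm_ge0 x : 0 <= rnorm x.
Proof. by rewrite -lecR -rnormE normr_ge0. Qed.

Lemma rnormD x y : rnorm (x + y) <= rnorm x + rnorm y.
Proof. by rewrite -lecR rmorphD/= -!rnormE ler_normD. Qed.

Lemma rnormN x : rnorm (- x) = rnorm x.
Proof. by rewrite /rnorm normrN. Qed.

Lemma rnormB x y : rnorm (x - y) <= rnorm x + rnorm y.
Proof. by rewrite -(rnormN y) rnormD. Qed.

Lemma rnormZ (a : R[i]) x : rnorm (a *: x) = complex.Re `|a| * rnorm x.
Proof.
apply: (@complexI R); rewrite rmorphM/= -!rnormE normrZ.
by rewrite (RRe_real (normr_real a)).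
Qed.

Lemma rnormZr (t : R) x : 0 <= t -> rnorm (t%:C *: x) = t * rnorm x.
Proof. by move=> t0; rewrite rnormZ ger0_norm// lecR. Qed.

Lemma rnormZi x : rnorm ('i%C *: x) = rnorm x.
Proof. by rewrite rnormZ normc_def/= expr0n expr1n/= add0r sqrtr1 mul1r. Qed.

Lemma closure_rnormP (A : set V) x :
  closure A x <-> forall e : R, 0 < e -> exists2 y, A y & rnorm (x - y) < e.
Proof.
split=> [Ax e e0|Ax B].
  have /Ax[y [Ay]] : nbhs x (ball x e%:C) by apply: nbhsx_ballx; rewrite ltcR.
  by rewrite -ball_normE/= rnormE ltcR => xy; exists y.
rewrite -nbhs_ballE => -[/= e e0 xeB].
have eE : e = (complex.Re e)%:C by rewrite RRe_real// gtr0_real.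
move: e0; rewrite eE ltcR => /Ax[y Ay xy]; exists y; split => //.
by apply: xeB; rewrite -ball_normE/= rnormE eE ltcR.
Qed.

End RealNorm.

(** Carries the limits of ternary products and sums below: a value at a point of the closure is
    within e/2 of a value on [A], itself within e/2 of [B]. *)
Lemma closure_lipschitz (R : realType) (V W : normedModType R[i])
    (f : V -> W) (M : R) (A : set V) (B : set W) :
    (forall x y, rnorm (f x - f y) <= M * rnorm (x - y)) ->
    (forall x, A x -> closure B (f x)) ->
  forall x, closure A x -> closure B (f x).
Proof.
move=> fM AB x /closure_rnormP Ax; apply/closure_rnormP => e e0.
(* Adding 1 keeps the divisor positive even when [M] is 0. *)
have d0 : 0 < e / 2 / (`|M| + 1) by rewrite !divr_gt0// ltr_pwDr.
have [y Ay xy] := Ax _ d0.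
have e20 : 0 < e / 2 by rewrite divr_gt0.
have /closure_rnormP/(_ _ e20)[z Bz yz] := AB _ Ay.
exists z => //; have := rnormD (f x - f y) (f y - z).
rewrite subrKA => /le_lt_trans; apply.
rewrite [ltRHS](splitr e) ler_ltD//.
apply: (le_trans (fM _ _)); move: xy; rewrite ltr_pdivlMr ?ltr_pwDr// => /ltW.
apply: le_trans; rewrite mulrC ler_wpM2l ?rnorm_ge0//.
by rewrite (le_trans (ler_norm _))// lerDl.
Qed.

(** * Norm estimates and sesquilinear calculus in a Hilbert module *)

Lemma rnorm_cstar (R : realType) (B : cstarAlgType R) (b : B) :
  rnorm (cstar b) = rnorm b.
Proof.
(* Cancel |x| in |x|^2 = |x* x| <= |x*| |x|; the converse is the same bound for x*. *)
have le (x : B) : rnorm x <= rnorm (cstar x).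
  have := cnormM (cstar x) x; rewrite cnorm_starM !rnormE.
  rewrite -rmorphXn -rmorphM lecR.
  have := rnorm_ge0 x; rewrite le_eqVlt => /predU1P[<- _|x0].
    exact: rnorm_ge0.
  by rewrite expr2 ler_pM2r.
by apply/eqP; rewrite eq_le le -{2}(cstarK b) le.
Qed.

Section HilbertModuleTheory.
Variables (R : realType) (B : cstarAlgType R) (E : hilbertModType B).
Implicit Types (x y z k e : E) (b : B) (a : R[i]).

Lemma rnorm_cmul (b c : B) : rnorm (cmul b c) <= rnorm b * rnorm c.
Proof. by rewrite -lecR rmorphM/= -!rnormE cnormM. Qed.

Lemma rnorm_starM (b : B) : rnorm (cmul (cstar b) b) = rnorm b ^+ 2.
Proof. by apply: (@complexI R); rewrite rmorphXn/= -!rnormE cnorm_starM. Qed.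

Lemma rnorm_inner x : rnorm (inner x x) = rnorm x ^+ 2.
Proof. by apply: (@complexI R); rewrite rmorphXn/= -!rnormE norm_inner. Qed.

Lemma cstarD (b c : B) : cstar (b + c) = cstar b + cstar c.
Proof. by rewrite -[b]scale1r cstar_antilinear rmorph1 !scale1r. Qed.

Lemma cstarB (b c : B) : cstar (b - c) = cstar b - cstar c.
Proof.
by rewrite addrC -scaleN1r cstar_antilinear rmorphN1 scaleN1r addrC.
Qed.

Lemma cstar0 : cstar (0 : B) = 0.
Proof. by have := cstarB 0 0; rewrite !subrr. Qed.

Lemma cstarZ a b : cstar (a *: b) = Num.conj a *: cstar b.
Proof. by rewrite -[a *: b]addr0 cstar_antilinear cstar0 addr0. Qed.

Lemma innerDr x y z : inner x (y + z) = inner x y + inner x z.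
Proof. by rewrite -[y]scale1r inner_linearr !scale1r. Qed.

Lemma innerBr x y z : inner x (y - z) = inner x y - inner x z.
Proof. by rewrite addrC -scaleN1r inner_linearr scaleN1r addrC. Qed.

Lemma inner0r x : inner x 0 = 0.
Proof. by have := innerBr x 0 0; rewrite !subrr. Qed.

Lemma innerZr a x y : inner x (a *: y) = a *: inner x y.
Proof. by rewrite -[a *: y]addr0 inner_linearr inner0r addr0. Qed.

Lemma innerDl x y z : inner (y + z) x = inner y x + inner z x.
Proof. by rewrite -inner_star innerDr cstarD !inner_star. Qed.

Lemma innerBl x y z : inner (y - z) x = inner y x - inner z x.
Proof. by rewrite -inner_star innerBr cstarB !inner_star. Qed.

Lemma innerZl a x y : inner (a *: x) y = Num.conj a *: inner x y.
Proof. by rewrite -inner_star innerZr cstarZ inner_star. Qed.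

Lemma inner0l x : inner 0 x = 0.
Proof. by rewrite -inner_star inner0r cstar0. Qed.

Lemma inner_ractl x y b : inner (ract x b) y = cmul (cstar b) (inner x y).
Proof. by rewrite -inner_star inner_ractr cstarM inner_star. Qed.

Lemma ractBl x y b : ract (x - y) b = ract x b - ract y b.
Proof. by rewrite addrC -scaleN1r ract_linearl scaleN1r addrC. Qed.

Lemma ractBr x (b c : B) : ract x (b - c) = ract x b - ract x c.
Proof. by rewrite addrC -scaleN1r ract_linearr scaleN1r addrC. Qed.

Lemma ract0r x : ract x 0 = 0.
Proof. by have := ractBr x 0 0; rewrite !subrr. Qed.

Lemma ractZr a x b : ract x (a *: b) = a *: ract x b.
Proof. by rewrite -[a *: b]addr0 ract_linearr ract0r addr0. Qed.

(** Squaring reduces this to |b* <x, x> b| <= |b|^2 |x|^2. *)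
Lemma rnorm_ract x b : rnorm (ract x b) <= rnorm x * rnorm b.
Proof.
rewrite -(ler_pXn2r (n := 2)) ?nnegrE ?mulr_ge0 ?rnorm_ge0//.
rewrite -rnorm_inner inner_ractl inner_ractr.
apply: (le_trans (rnorm_cmul _ _)); rewrite rnorm_cstar exprMn mulrC.
rewrite [_ ^+ 2 in leRHS]expr2 [leRHS]mulrC mulrAC.
rewrite ler_wpM2r ?rnorm_ge0// (le_trans (rnorm_cmul _ _))//.
by rewrite rnorm_inner mulrC.
Qed.

End HilbertModuleTheory.

(** * Polarization, a weak Cauchy-Schwarz inequality and Richardson iteration *)

Lemma conj_imaginary (R : realType) : Num.conj ('i%C : R[i]) = - 'i%C.
Proof. by apply/eqP; rewrite eq_complex/= oppr0 !eqxx. Qed.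

Lemma conj_realC (R : realType) (x : R) : Num.conj (x%:C) = x%:C.
Proof. exact: conjc_real. Qed.

Lemma mul_imaginary (R : realType) : 'i%C * 'i%C = - 1 :> R[i].
Proof. by rewrite -expr2 sqr_i. Qed.

Section Inner.
Variables (R : realType) (B : cstarAlgType R) (E : hilbertModType B).
Implicit Types (x y z k e : E) (b : B) (a : R[i]).

(** Polarization: the sum is <x + y, x + y> minus <x, x> and <y, y>, whose norms are squares of
    norms. *)
Lemma rnorm_innerD x y :
  rnorm (inner x y + inner y x) <=
    (rnorm x + rnorm y) ^+ 2 + (rnorm x ^+ 2 + rnorm y ^+ 2).
Proof.
have -> : inner x y + inner y x =
    inner (x + y) (x + y) - (inner x x + inner y y).
  by rewrite innerDr !innerDl [inner x x + _]addrC addrACA addrK addrC.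
apply: (le_trans (rnormB _ _)); apply: lerD; rewrite ?rnorm_inner.
  by rewrite ler_pXn2r ?nnegrE ?addr_ge0 ?rnorm_ge0 ?rnormD.
by rewrite (le_trans (rnormD _ _))// !rnorm_inner.
Qed.

(** Replacing y by iy turns the sum of the previous bound into i times the difference and keeps the
    norms. *)
Lemma rnorm_innerB x y :
  rnorm (inner x y - inner y x) <=
    (rnorm x + rnorm y) ^+ 2 + (rnorm x ^+ 2 + rnorm y ^+ 2).
Proof.
have := rnorm_innerD x ('i%C *: y).
rewrite innerZr innerZl conj_imaginary scaleNr -scalerBr !rnormZi.
exact.
Qed.

(* The Cauchy-Schwarz inequality with constant 6 in place of 1: polarization
   and the triangle inequality suffice. *)
Lemma rnorm_innerM x y : rnorm (inner x y) <= 6 * rnorm x * rnorm y.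
Proof.
(* On unit vectors both bounds equal (1 + 1)^2 + 1 + 1 = 6, and 2<u, v> is the sum of the two
   bounded terms. Scaling gives the general case. *)
have unit (u v : E) : rnorm u = 1 -> rnorm v = 1 -> rnorm (inner u v) <= 6.
  move=> u1 v1; have := rnorm_innerD u v; have := rnorm_innerB u v.
  rewrite u1 v1 => D S.
  have : rnorm ((2 : R)%:C *: inner u v) <= 12.
    have -> : (2 : R)%:C *: inner u v =
        (inner u v + inner v u) + (inner u v - inner v u).
      by rewrite rmorph_nat scaler_nat mulr2n addrACA subrr addr0.
    by apply: (le_trans (rnormD _ _)); lra.
  by rewrite rnormZr//; lra.
have [->|x0] := eqVneq x 0.
  by rewrite inner0l /rnorm !normr0 mulr0 mul0r.
have [->|y0] := eqVneq y 0.
  by rewrite inner0r /rnorm !normr0 mulr0.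
have pos (z : E) : z != 0 -> 0 < rnorm z.
  by rewrite -normr_gt0 rnormE ltcR.
have scl (z : E) : z != 0 -> rnorm ((rnorm z)^-1%:C *: z) = 1.
  by move=> z0; rewrite rnormZr ?invr_ge0 ?rnorm_ge0// mulVf// gt_eqF ?pos.
have := unit _ _ (scl _ x0) (scl _ y0).
rewrite innerZr innerZl conj_realC !rnormZr ?invr_ge0 ?rnorm_ge0//.
rewrite mulrA -invfM mulrC ler_pdivrMr ?mulr_gt0 ?pos//.
by move=> /le_trans; apply; lra.
Qed.

(** The cross terms add up to i s t (<x, y> - <y, x>), which vanishes by hypothesis; a Pythagorean
    bound remains. *)
Lemma rnorm_rotation x y (s t : R) : inner x y = inner y x ->
  rnorm (s%:C *: x + 'i%C *: (t%:C *: y)) ^+ 2 <=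
    s ^+ 2 * rnorm x ^+ 2 + t ^+ 2 * rnorm y ^+ 2.
Proof.
move=> xy; rewrite -rnorm_inner.
have -> : inner (s%:C *: x + 'i%C *: (t%:C *: y))
    (s%:C *: x + 'i%C *: (t%:C *: y)) =
    (s ^+ 2)%:C *: inner x x + (t ^+ 2)%:C *: inner y y.
  rewrite innerDr !innerDl !innerZl !innerZr conj_imaginary.
  rewrite !conj_realC -xy !scalerA.
  rewrite addrA -[_ + _ + (_ *: inner x y)]addrA -scalerDl.
  have -> : - 'i%C * t%:C * s%:C + s%:C * ('i%C * t%:C) = 0 :> R[i] by ring.
  rewrite scale0r addr0 !rmorphXn/=; congr (_ *: _ + _ *: _).
  by rewrite mulrACA mulNr mul_imaginary opprK mul1r.
apply: (le_trans (rnormD _ _)).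
by rewrite !rnormZr ?sqr_ge0// !rnorm_inner.
Qed.

(** The defect of [e] as a solution of (T + i eps) e = k, where T e = k<k, e>. *)
Definition residual k (eps : R) e :=
  k - ract k (inner k e) - 'i%C *: (eps%:C *: e).

(* One step of Richardson iteration for (T + i eps) e = k, where
   T e = k <k, e>: the cross terms in <r', r'> cancel because T is
   self-adjoint. *)
Lemma residual_step k (eps : R) : 0 < eps -> exists2 q : R, 0 <= q < 1 &
  forall e, exists e',
    rnorm (residual k eps e') ^+ 2 <= q * rnorm (residual k eps e) ^+ 2.
Proof.
(* [M] bounds T: |T r| <= |k| |<k, r>| <= 6 |k|^2 |r|. *)
move=> eps0; pose M := 6 * rnorm k ^+ 2; pose D := eps ^+ 2 + M ^+ 2.
have D0 : 0 < D by rewrite ltr_pwDl ?exprn_gt0// sqr_ge0.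
exists (M ^+ 2 / D).
  by rewrite divr_ge0 ?sqr_ge0 ?ltW//= ltr_pdivrMr// mul1r ltrDr exprn_gt0.
move=> e; have [r rE] : exists r, r = residual k eps e by eexists.
(* This [t] minimizes (1 - eps t)^2 + t^2 M^2, and the minimum is M^2 / D. *)
rewrite -rE; pose t := eps / D.
pose Tr := ract k (inner k r).
exists (e - 'i%C *: (t%:C *: r)).
(* The correction changes the residual by (T + i eps)(i t r) = i t T r - eps t r. *)
have -> : residual k eps (e - 'i%C *: (t%:C *: r)) =
    (1 - eps * t)%:C *: r + 'i%C *: (t%:C *: Tr).
  rewrite /residual innerBr !innerZr ractBr !ractZr !scalerBr -/Tr.
  have -> : 'i%C *: (eps%:C *: ('i%C *: (t%:C *: r))) = - ((eps * t)%:C *: r).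
    rewrite !scalerA -scaleNr; congr (_ *: _).
    rewrite ['i%C * _ * _]mulrAC mul_imaginary mulN1r mulNr.
    by rewrite [in RHS](rmorphM (real_complex R)).
  rewrite rmorphB/= rmorph1 scalerBl scale1r opprK opprB opprD {2}rE /residual.
  by rewrite !addrA [LHS](ACl (1*3*4*5*2))/=.
apply: (le_trans (rnorm_rotation _ _ _)).
  by rewrite /Tr inner_ractr inner_ractl inner_star.
have TM : rnorm Tr ^+ 2 <= M ^+ 2 * rnorm r ^+ 2.
  rewrite -exprMn ler_pXn2r ?nnegrE ?mulr_ge0 ?sqr_ge0 ?rnorm_ge0//.
  apply: (le_trans (rnorm_ract _ _)).
  have := rnorm_innerM k r; rewrite /M => H.
  by have := ler_wpM2l (rnorm_ge0 k) H; congr (_ <= _); ring.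
have le : (1 - eps * t) ^+ 2 * rnorm r ^+ 2 + t ^+ 2 * rnorm Tr ^+ 2
    <= ((1 - eps * t) ^+ 2 + t ^+ 2 * M ^+ 2) * rnorm r ^+ 2.
  by rewrite mulrDl lerD2l -[leRHS]mulrA ler_wpM2l ?sqr_ge0.
apply: (le_trans le); rewrite le_eqVlt; apply/orP; left.
apply/eqP; congr (_ * _).
by rewrite /t; move: (gt_eqF D0); rewrite /D => /negbT ?; field.
Qed.

End Inner.

(** * Approximation by k<k, e> *)

Section Approx.
Variables (R : realType) (B : cstarAlgType R) (E : hilbertModType B).
Implicit Types (x y z k e : E) (b : B) (a : R[i]).

(** Iterating the contraction from e = 0, whose residual is k, makes the residual decay
    geometrically. *)
Lemma residual_small k (eps d : R) : 0 < eps -> 0 < d ->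
  exists e, rnorm (residual k eps e) <= d.
Proof.
move=> eps0 d0; have [q /andP[q0 q1] step] := residual_step k eps0.
have iterate n : exists e,
    rnorm (residual k eps e) ^+ 2 <= q ^+ n * rnorm k ^+ 2.
  elim: n => [|n [e IHe]].
    exists 0; rewrite expr0 mul1r /residual inner0r ract0r !scaler0.
    by rewrite !subr0.
  have [e' e'le] := step e; exists e'; apply: (le_trans e'le).
  by rewrite [q ^+ _]exprS -[leRHS]mulrA ler_wpM2l.
(* The added 1 keeps this threshold positive when k = 0. *)
have c0 : 0 < d ^+ 2 / (rnorm k ^+ 2 + 1).
  by rewrite divr_gt0 ?exprn_gt0// ltr_wpDl ?sqr_ge0.
have /cvgrPdist_lt/(_ _ c0)[n _ /(_ n (leqnn n))] : q ^+ n @[n --> \oo] --> 0.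
  by apply: cvg_expr; rewrite ger0_norm.
rewrite /= sub0r normrN ger0_norm ?exprn_ge0// ltr_pdivlMr; last first.
  by rewrite ltr_wpDl ?sqr_ge0.
move=> qn; have [e le] := iterate n; exists e.
rewrite -(ler_pXn2r (n := 2)) ?nnegrE ?rnorm_ge0 ?(ltW d0)//.
apply: (le_trans le); apply: le_trans (ltW qn).
by rewrite ler_wpM2l ?exprn_ge0// lerDl.
Qed.

(** Pairing k = kc + i eps e + r with e, where c = <k, e>, gives c* = c* c + i eps <e, e> + w. Its
    self-adjoint part bounds |c|, its skew part bounds eps |e|^2, both by |c| + |w|. *)
Lemma rnorm_solution k (eps : R) e : 0 < eps <= 12^-1 ->
    rnorm (residual k eps e) <= eps / 6 ->
  (eps * rnorm e) ^+ 2 <= 3 * eps.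
Proof.
move=> /andP[eps0 eps12]; set r := residual k eps e => re.
pose c := inner k e; pose w := inner e r.
have kE : k = ract k c + 'i%C *: (eps%:C *: e) + r.
  by rewrite /r /residual -[k - _ - _]addrA -opprD [RHS]addrC subrK.
have cS : cstar c = inner e k := inner_star _ _.
have cE : cstar c = cmul (cstar c) c + 'i%C *: (eps%:C *: inner e e) + w.
  by rewrite {1}cS {1}kE 2!innerDr inner_ractr !innerZr cS.
have cE' : c = cmul (cstar c) c - 'i%C *: (eps%:C *: inner e e) + cstar w.
  rewrite -{1}(cstarK c) {1}cE !cstarD !cstarZ conj_imaginary conj_realC.
  by rewrite cstarM cstarK inner_star scaleNr.
have [sumE diffE] : cstar c + c - (w + cstar w) = cmul (cstar c) c *+ 2 /\
    cstar c - c - (w - cstar w) = ('i%C *: (eps%:C *: inner e e)) *+ 2.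
  move: cE cE'; move: (cmul _ _) ('i%C *: _) (cstar w) => p q v -> {1 2}->.
  rewrite !mulr2n; split.
    by rewrite addrACA addrK addrACA subrr addr0.
  rewrite [- (_ + v)]opprD opprB addrACA addrK [p + q]addrC addrACA subrr.
  by rewrite addr0.
have e0 := rnorm_ge0 e.
(* The 6 in the hypothesis eps / 6 absorbs the constant of [rnorm_innerM]. *)
have w_le : rnorm w <= eps * rnorm e.
  apply: (le_trans (rnorm_innerM _ _)).
  by have := ler_wpM2l e0 re; lra.
have c2 : rnorm c ^+ 2 <= rnorm c + rnorm w.
  have : rnorm ((2 : R)%:C *: cmul (cstar c) c) <= 2 * (rnorm c + rnorm w).
    rewrite rmorph_nat scaler_nat -sumE.
    apply: (le_trans (rnormB _ _)).
    have := rnormD (cstar c) c; have := rnormD w (cstar w).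
    by rewrite !rnorm_cstar; lra.
  by rewrite rnormZr// rnorm_starM; lra.
have e2 : eps * rnorm e ^+ 2 <= rnorm c + rnorm w.
  have : rnorm ((2 : R)%:C *: ('i%C *: (eps%:C *: inner e e)))
      <= 2 * (rnorm c + rnorm w).
    rewrite rmorph_nat scaler_nat -diffE.
    apply: (le_trans (rnormB _ _)).
    have := rnormB (cstar c) c; have := rnormB w (cstar w).
    by rewrite !rnorm_cstar; lra.
  by rewrite rnormZr// rnormZi rnormZr ?(ltW eps0)// rnorm_inner; lra.
have := rnorm_ge0 c; move: e2 c2 w_le.
set s := eps * rnorm e; move=> e2 c2 w_le c0.
have s0 : 0 <= s by rewrite mulr_ge0// ltW.
(* From |c|^2 <= |c| + s: if |c| exceeded 1 + s, then |c|^2 would exceed |c| + s |c| >= |c| + s. *)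
have c_le : rnorm c <= 1 + s by nra.
have s2 : s ^+ 2 <= eps * (1 + 2 * s).
  rewrite /s exprMn [eps ^+ 2]expr2 -mulrA ler_pM2l// (le_trans e2)//.
  by rewrite -/s; lra.
(* If s > 1, the bound [s2] with eps <= 1/12 would force s^2 < s / 4. *)
have s1 : s <= 1 by nra.
by nra.
Qed.

(* With T e = k <k, e>, solving (T + i eps) e = k up to a small error makes
   eps e small, uniformly in the size of e, so that k <k, e> is close to k. *)
Lemma closure_ract_inner k : closure [set ract k (inner k e) | e in setT] k.
Proof.
apply/closure_rnormP => h h0.
(* The choice of [eps] turns s^2 <= 3 eps into s <= h1 / 2, and h1 <= 1 makes both eps <= 1/12 and
   eps / 6 < h1 / 2. *)
pose h1 := Num.min 1 h; pose eps := h1 ^+ 2 / 12.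
have h10 : 0 < h1 by rewrite lt_min ltr01 h0.
have h11 : h1 <= 1 by rewrite ge_min lexx.
have eps0 : 0 < eps by rewrite divr_gt0 ?exprn_gt0.
have eps12 : 0 < eps <= 12^-1 by rewrite eps0 /eps; nra.
have d0 : 0 < eps / 6 by rewrite divr_gt0.
have [e re] := residual_small k eps0 d0.
exists (ract k (inner k e)); first by exists e.
have := rnorm_solution eps12 re; set s := eps * rnorm e => s2.
have s0 : 0 <= s by rewrite mulr_ge0 ?rnorm_ge0// ltW.
apply: (@lt_le_trans _ _ h1); last by rewrite ge_min lexx orbT.
have -> : k - ract k (inner k e) = residual k eps e + 'i%C *: (eps%:C *: e).
  by rewrite /residual subrK.
apply: (le_lt_trans (rnormD _ _)).
rewrite rnormZi rnormZr ?(ltW eps0)// -/s.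
have s_le : s <= h1 / 2 by move: s2; rewrite /eps; nra.
by move: re; rewrite /eps; nra.
Qed.

End Approx.

(** * Ternary ideals *)

Section TernaryIdealTheory.
Variables (R : realType) (B : cstarAlgType R) (E : hilbertModType B).
Implicit Types (x y z k e : E) (K : set E).

Lemma ract_lipschitz (b : B) x y :
  rnorm (ract x b - ract y b) <= rnorm b * rnorm (x - y).
Proof. by rewrite -ractBl mulrC rnorm_ract. Qed.

Lemma ract_inner_lipschitzr z w x y :
  rnorm (ract z (inner w x) - ract z (inner w y)) <=
    (rnorm z * (6 * rnorm w)) * rnorm (x - y).
Proof.
rewrite -ractBr -innerBr (le_trans (rnorm_ract _ _))// -mulrA.
by rewrite ler_wpM2l ?rnorm_ge0 ?rnorm_innerM.
Qed.

Lemma ract_inner_lipschitzl z w x y :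
  rnorm (ract z (inner x w) - ract z (inner y w)) <=
    (rnorm z * (6 * rnorm w)) * rnorm (x - y).
Proof.
rewrite -ractBr -innerBl (le_trans (rnorm_ract _ _))// -mulrA.
by rewrite ler_wpM2l ?rnorm_ge0// mulrAC rnorm_innerM.
Qed.

Lemma closed_ternary_ideal_conditions K : closed K ->
  ternary_product setT K setT `<=` K -> condition_a K /\ condition_b K.
Proof.
move=> /closure_id Kcl EKE; split=> _ [x [y [z [Kx Ky Kz ->]]]].
- rewrite Kcl.
  apply: (closure_lipschitz (ract_inner_lipschitzr x y)
    (A := [set ract z (inner z e) | e in setT]));
    last exact: closure_ract_inner.
  (* x<y, z<z, e>> = (x<y, z>)<z, e>, with z in [K] now in the middle slot. *)
  move=> _ [e _ <-]; apply: subset_closure; apply: EKE.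
  by exists (ract x (inner y z)), z, e; rewrite inner_ractr -ractA.
- rewrite Kcl; apply: (closure_lipschitz (ract_lipschitz (inner y z))
    (A := [set ract x (inner x e) | e in setT]));
    last exact: closure_ract_inner.
  (* (x<x, e>)<y, z> = x<x, e<y, z>>, with the second x as the middle element of [K]. *)
  move=> _ [e _ <-]; apply: subset_closure; apply: EKE.
  by exists x, x, (ract e (inner y z)); rewrite inner_ractr -ractA.
Qed.

Lemma closure_ternary_product K : condition_a K -> condition_b K ->
  ternary_product setT (closure K) setT `<=` closure K.
Proof.
move=> aK bK _ [x [y [z [_ Ky _ ->]]]].
(* Two successive limits: from the closure down to k in [K], then from k to k<k, e>. *)
apply: (closure_lipschitz (ract_inner_lipschitzl x z)) Ky => k Kk.
apply: (closure_lipschitz (ract_inner_lipschitzl x z)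
  (A := [set ract k (inner k e) | e in setT]));
    last exact: closure_ract_inner.
move=> _ [e _ <-]; apply: subset_closure.
rewrite inner_ractl inner_star -ractA; apply: bK.
exists (ract x (inner e k)), k, z; split=> //; apply: aK.
by exists x, e, k.
Qed.

Lemma closure_linear_subspace K :
  linear_subspace K -> linear_subspace (closure K).
Proof.
move=> [K0 KD]; split.
  by rewrite inE; apply: subset_closure; rewrite inE in K0.
move=> a u v; rewrite !inE => Ku Kv.
have lipD (w : E) (x y : E) : rnorm (w + x - (w + y)) <= 1 * rnorm (x - y).
  by rewrite mul1r opprD addrACA subrr add0r.
apply: (closure_lipschitz (lipD (a *: u))) Kv => v' Kv'.
have lipZ (x y : E) : rnorm (a *: x + v' - (a *: y + v')) <=
    complex.Re `|a| * rnorm (x - y).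
  by rewrite opprD addrACA subrr addr0 -scalerBr rnormZ.
apply: (closure_lipschitz lipZ) Ku => u' Ku'.
apply: subset_closure.
by have := KD a u' v'; rewrite !inE; apply.
Qed.

End TernaryIdealTheory.

(** * The C*-algebra of complex matrices *)

(** The Euclidean norm; rows are used, so matrices act from the right. *)
HB.lock Definition rownorm (C : numClosedFieldType) (n : nat) (x : 'rV[C]_n) :=
  sqrtC (dotmx x x).

Section RowNorm.
Variables (C : numClosedFieldType) (n : nat).
Implicit Types (x y : 'rV[C]_n) (A : 'M[C]_n).

Lemma rownorm_ge0 x : 0 <= rownorm x.
Proof. by rewrite rownorm.unlock sqrtC_ge0 (dnorm_ge0 (@dotmx C n)). Qed.

Lemma rownormD x y : rownorm (x + y) <= rownorm x + rownorm y.
Proof.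
by rewrite rownorm.unlock; have [] := triangle_lerif (@dotmx C n) x y.
Qed.

Lemma rownormZ (a : C) x : rownorm (a *: x) = `|a| * rownorm x.
Proof.
rewrite rownorm.unlock (dnormZ (@dotmx C n)).
rewrite sqrtCM ?nnegrE ?exprn_ge0 ?normr_ge0//.
by rewrite sqrCK ?normr_ge0.
Qed.

Lemma rownorm_CauchySchwarz x y : `|dotmx x y| <= rownorm x * rownorm y.
Proof.
by rewrite rownorm.unlock; have [] := CauchySchwarz_sqrt (@dotmx C n) x y.
Qed.

Lemma sqr_rownorm x : rownorm x ^+ 2 = dotmx x x.
Proof. by rewrite rownorm.unlock sqrtCK. Qed.

Lemma dotmx_adj x y A : dotmx (x *m A) y = dotmx x (y *m A^t*).
Proof.
by rewrite !dotmxE trmx_mul map_mxM /= trmxCK mulmxA.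
Qed.

Lemma dotmx_sum x : dotmx x x = \sum_i `|x 0 i| ^+ 2.
Proof.
by rewrite dotmxE mxE; apply: eq_bigr => i _; rewrite !mxE normCK.
Qed.

Lemma norm_coord_le_rownorm x i : `|x 0 i| <= rownorm x.
Proof.
rewrite -(ler_pXn2r (n := 2)) ?nnegrE ?normr_ge0 ?rownorm_ge0//.
rewrite sqr_rownorm dotmx_sum (bigD1 i)//= lerDl.
by apply: sumr_ge0 => j _; rewrite exprn_ge0.
Qed.

Lemma rownorm_delta (i : 'I_n) : rownorm (delta_mx 0 i : 'rV[C]_n) = 1.
Proof.
rewrite -[LHS](sqrCK (rownorm_ge0 _)) sqr_rownorm dotmx_sum.
rewrite (bigD1 i)//= big1 => [|j /negbTE ji].
  by rewrite mxE !eqxx normr1 expr1n addr0 sqrtC1.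
by rewrite mxE ji andbF normr0 expr0n.
Qed.

Lemma rownorm_sum (I : finType) (F : I -> 'rV[C]_n) :
  rownorm (\sum_i F i) <= \sum_i rownorm (F i).
Proof.
elim/big_ind2: _ => // [|x1 x2 y1 y2 le1 le2].
  by rewrite -(scale0r 0) rownormZ normr0 mul0r.
by rewrite (le_trans (rownormD _ _))// lerD.
Qed.

Lemma rownorm_le_sum x : rownorm x <= \sum_i `|x 0 i|.
Proof.
rewrite {1}(row_sum_delta x) (le_trans (rownorm_sum _))//.
by apply: ler_sum => i _; rewrite rownormZ rownorm_delta mulr1.
Qed.

(** A crude bound, but finite: it makes the set of bounds in [opnorm] nonempty and later controls
    [opnorm] by the entries. *)
Lemma rownorm_mulmx x A :
  rownorm (x *m A) <= (\sum_i \sum_j `|A i j|) * rownorm x.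
Proof.
rewrite mulmx_sum_row (le_trans (rownorm_sum _))// mulr_suml.
apply: ler_sum => i _; rewrite rownormZ mulrC.
rewrite ler_pM ?rownorm_ge0 ?normr_ge0 ?norm_coord_le_rownorm//.
rewrite (le_trans (rownorm_le_sum _))//.
by under eq_bigr do rewrite mxE.
Qed.

Lemma norm_entry_le_rownorm A i j : `|A i j| <= rownorm (delta_mx 0 i *m A).
Proof.
by rewrite -rowE (le_trans _ (norm_coord_le_rownorm _ j))// mxE.
Qed.

End RowNorm.

HB.lock Definition opnorm (R : realType) (n : nat) (A : 'M[R[i]]_n) : R :=
  inf [set c : R | 0 <= c /\ forall x, rownorm (x *m A) <= c%:C * rownorm x].

Section OperatorNorm.
Variables (R : realType) (n : nat).
Implicit Types (x y : 'rV[R[i]]_n) (A B : 'M[R[i]]_n).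

Lemma complex_ge0E (z : R[i]) : 0 <= z -> z = (complex.Re z)%:C.
Proof. by move=> /ger0_real/RRe_real. Qed.

Let has_inf_bounds A : has_inf
  [set c : R | 0 <= c /\ forall x, rownorm (x *m A) <= c%:C * rownorm x].
Proof.
split; last by exists 0 => c [].
have s0 : 0 <= \sum_i \sum_j `|A i j|.
  by apply: sumr_ge0 => i _; apply: sumr_ge0.
exists (complex.Re (\sum_i \sum_j `|A i j|)); split.
  by rewrite -lecR -complex_ge0E.
by move=> x; rewrite -complex_ge0E// rownorm_mulmx.
Qed.

Lemma opnorm_ge0 A : 0 <= opnorm A.
Proof.
rewrite opnorm.unlock; apply: lb_le_inf; last by move=> c [].
by case: (has_inf_bounds A).
Qed.

Lemma opnorm_le A (c : R) : 0 <= c ->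
  (forall x, rownorm (x *m A) <= c%:C * rownorm x) -> opnorm A <= c.
Proof.
rewrite opnorm.unlock => c0 cA; apply: ge_inf => //.
by case: (has_inf_bounds A).
Qed.

(** The infimum is itself a bound: for x of nonzero norm, |xA| / |x| lies below every admissible c,
    hence below their infimum. *)
Lemma rownorm_le_opnorm A x :
  rownorm (x *m A) <= (opnorm A)%:C * rownorm x.
Proof.
have [x0|x0] := eqVneq (rownorm x) 0.
  by have := rownorm_mulmx x A; rewrite x0 !mulr0.
have xA0 := rownorm_ge0 (x *m A); have xge0 := rownorm_ge0 x.
rewrite -ler_pdivrMr ?lt_def ?x0//.
rewrite (complex_ge0E (divr_ge0 xA0 xge0)) lecR.
rewrite opnorm.unlock; apply: lb_le_inf; first by case: (has_inf_bounds A).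
move=> c [c0 cA]; rewrite -lecR -(complex_ge0E (divr_ge0 xA0 xge0)).
by rewrite ler_pdivrMr ?lt_def ?x0.
Qed.

Lemma opnormD A B : opnorm (A + B) <= opnorm A + opnorm B.
Proof.
apply: opnorm_le => [|x]; first by rewrite addr_ge0 ?opnorm_ge0.
rewrite mulmxDr (le_trans (rownormD _ _))// rmorphD mulrDl.
by rewrite lerD ?rownorm_le_opnorm.
Qed.

Lemma opnormM A B : opnorm (A *m B) <= opnorm A * opnorm B.
Proof.
have Age0 := opnorm_ge0 A; have Bge0 := opnorm_ge0 B.
apply: opnorm_le => [|x]; first exact: mulr_ge0.
rewrite mulmxA. 
apply: le_trans (rownorm_le_opnorm _ _) _.
by rewrite rmorphM/= mulrAC mulrC ler_wpM2r ?lecR// rownorm_le_opnorm.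
Qed.

Lemma opnormZ_le (a : R[i]) A : opnorm (a *: A) <= complex.Re `|a| * opnorm A.
Proof.
have a0 : 0 <= complex.Re `|a|.
  by rewrite -lecR -(complex_ge0E (normr_ge0 a)) normr_ge0.
apply: opnorm_le => [|x]; first exact: mulr_ge0 a0 (opnorm_ge0 A).
rewrite -scalemxAr rownormZ rmorphM/= -(complex_ge0E (normr_ge0 a)) -mulrA.
by rewrite ler_wpM2l ?rownorm_le_opnorm.
Qed.

Lemma norm_entry_le_opnorm A i j : `|A i j| <= (opnorm A)%:C.
Proof.
apply: (le_trans (norm_entry_le_rownorm _ _ _)).
by rewrite (le_trans (rownorm_le_opnorm _ _))// rownorm_delta mulr1.
Qed.

(** With [norm_entry_le_opnorm] this identifies norm convergence with entrywise convergence, the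
    basis of completeness. *)
Lemma opnorm_le_sum A : (opnorm A)%:C <= \sum_i \sum_j `|A i j|.
Proof.
have s0 : 0 <= \sum_i \sum_j `|A i j|.
  by apply: sumr_ge0 => i _; apply: sumr_ge0.
rewrite (complex_ge0E s0) lecR; apply: opnorm_le => [|x].
  by rewrite -lecR -complex_ge0E.
by rewrite -complex_ge0E// rownorm_mulmx.
Qed.

Lemma opnorm0_eq0 A : opnorm A = 0 -> A = 0.
Proof.
move=> A0; apply/matrixP => i j; rewrite mxE; apply/eqP; rewrite -normr_le0.
by rewrite (le_trans (norm_entry_le_opnorm _ _ _))// A0.
Qed.

(** The hard half of the C*-identity: |xA|^2 is the inner product of x with x A A*, and
    Cauchy-Schwarz applies. *)
Lemma sqr_opnorm_le A : opnorm A ^+ 2 <= opnorm (A *m A^t*).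
Proof.
set b := opnorm (A *m A^t*).
have b0 : 0 <= b := opnorm_ge0 _.
rewrite -[b]sqr_sqrtr// ler_pXn2r ?nnegrE ?opnorm_ge0 ?sqrtr_ge0//.
apply: opnorm_le => [|x]; first exact: sqrtr_ge0.
rewrite -(ler_pXn2r (n := 2)) ?nnegrE ?mulr_ge0 ?rownorm_ge0 ?lecR ?sqrtr_ge0//.
rewrite exprMn -rmorphXn/= sqr_sqrtr// sqr_rownorm.
have xx : 0 <= dotmx (x *m A) (x *m A).
  by rewrite -sqr_rownorm exprn_ge0 ?rownorm_ge0.
rewrite -(ger0_norm xx) dotmx_adj -mulmxA.
apply: (le_trans (rownorm_CauchySchwarz _ _)).
by rewrite mulrC expr2 mulrA ler_wpM2r ?rownorm_ge0 ?rownorm_le_opnorm.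
Qed.

Lemma opnorm_adj A : opnorm (A^t*) = opnorm A.
Proof.
have le (D : 'M[R[i]]_n) : opnorm D <= opnorm (D^t*).
  have := le_trans (sqr_opnorm_le D) (opnormM _ _).
  have := opnorm_ge0 D; rewrite le_eqVlt => /predU1P[<- _|D0].
    exact: opnorm_ge0.
  by rewrite expr2 ler_pM2l.
by apply/eqP; rewrite eq_le le -{2}(trmxCK A) le.
Qed.

Lemma opnorm_adjM A : opnorm (A^t* *m A) = opnorm A ^+ 2.
Proof.
apply/eqP; rewrite eq_le; apply/andP; split.
  by rewrite (le_trans (opnormM _ _))// opnorm_adj expr2.
by have := sqr_opnorm_le (A^t*); rewrite trmxCK opnorm_adj.
Qed.

Lemma opnormZ (a : R[i]) A : opnorm (a *: A) = complex.Re `|a| * opnorm A.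
Proof.
have [->|a0] := eqVneq a 0.
  rewrite scale0r normr0 mul0r; apply/eqP; rewrite eq_le opnorm_ge0 andbT.
  by have := opnormZ_le 0 0; rewrite scale0r normr0 mul0r.
apply/eqP; rewrite eq_le opnormZ_le/=.
have a_gt0 : 0 < complex.Re `|a|.
  by rewrite -ltcR -(complex_ge0E (normr_ge0 a)) normr_gt0.
(* The reverse inequality is [opnormZ_le] for the inverse scalar applied to [a *: A]. *)
rewrite mulrC -ler_pdivlMr// mulrC.
have -> : (complex.Re `|a|)^-1 = complex.Re `|a^-1|.
  apply: (@complexI R).
  rewrite -(complex_ge0E (normr_ge0 a^-1)) fmorphV/=.
  rewrite -(complex_ge0E (normr_ge0 a)).
  by rewrite normfV.
by have := opnormZ_le a^-1 (a *: A); rewrite scalerA mulVf// scale1r.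
Qed.

End OperatorNorm.

Lemma normc_ge_Im (R : rcfType) (z : R[i]) : `|complex.Im z|%:C <= `|z|.
Proof.
by rewrite normc_def lecR -sqrtr_sqr ler_sqrt ?lerDr ?addr_ge0 ?sqr_ge0.
Qed.

Lemma normc_le_ReIm (R : rcfType) (z : R[i]) :
  `|z| <= (`|complex.Re z| + `|complex.Im z|)%:C.
Proof.
rewrite normc_def lecR.
rewrite -(ler_pXn2r (n := 2)) ?nnegrE ?sqrtr_ge0 ?addr_ge0//.
rewrite sqr_sqrtr ?addr_ge0 ?sqr_ge0// sqrrD !real_normK ?num_real//.
by rewrite lerD2r lerDl mulrn_wge0// mulr_ge0.
Qed.

(* A copy of the type of matrices: matrices already carry the entrywise
   maximum norm, which is not a C*-norm. *)
Definition opmx (R : realType) (n : nat) : Type := 'M[R[i]]_n.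

Section OperatorMatrix.
Variables (R : realType) (n : nat).

HB.instance Definition _ := GRing.Lmodule.copy (opmx R n) 'M[R[i]]_n.

Let opmx_norm (A : opmx R n) : R[i] := (opnorm A)%:C.

Let opmx_normD (A B : opmx R n) :
  opmx_norm (A + B) <= opmx_norm A + opmx_norm B.
Proof. by rewrite /opmx_norm -rmorphD lecR opnormD. Qed.

Let opmx_normZ (a : R[i]) (A : opmx R n) :
  opmx_norm (a *: A) = `|a| * opmx_norm A.
Proof.
by rewrite /opmx_norm opnormZ rmorphM/= -(complex_ge0E (normr_ge0 a)).
Qed.

Let opmx_norm_eq0 (A : opmx R n) : opmx_norm A = 0 -> A = 0.
Proof. by move=> /complexI/opnorm0_eq0. Qed.

HB.instance Definition _ := Lmodule_isNormed.Build R[i] (opmx R n)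
  opmx_normD opmx_normZ opmx_norm_eq0.

Lemma opmx_normE (A : opmx R n) : `|A| = (opnorm A)%:C.
Proof. by []. Qed.

Lemma opmxB_entry (A B : opmx R n) i j : (A - B) i j = A i j - B i j.
Proof. by rewrite !mxE. Qed.

(** Real and imaginary parts of entries are 1-Lipschitz for the operator norm, so they converge in
    [R]; the matrix of these limits is the limit. *)
Let opmx_complete (F : set_system (opmx R n)) :
  ProperFilter F -> cauchy F -> cvg F.
Proof.
move=> FF /cauchy_ballP Fc.
have lim_of (f : opmx R n -> R) :
    (forall A B, `|f A - f B| <= opnorm (A - B)) ->
    exists l, forall e : R, 0 < e -> \forall A \near F, `|l - f A| < e.
  move=> fL; have : cauchy (f @ F).
    apply/cauchy_ballP => e e0; rewrite !near_simpl.
    have eC0 : 0 < e%:C by rewrite ltcR.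
    apply: filterS (Fc _ eC0) => -[A B] /=.
    rewrite -ball_normE/= opmx_normE ltcR => AB; rewrite /ball/=.
    exact: le_lt_trans (fL _ _) AB.
  move=> /R_complete/cvg_ex[l /cvgrPdist_lt fl].
  by exists l.
pose fRe (ij : 'I_n * 'I_n) (A : opmx R n) := complex.Re (A ij.1 ij.2).
pose fIm (ij : 'I_n * 'I_n) (A : opmx R n) := complex.Im (A ij.1 ij.2).
have /choice[re reP] : forall ij : 'I_n * 'I_n, exists l, forall e : R, 0 < e ->
    \forall A \near F, `|l - fRe ij A| < e.
  move=> [i j]; apply: lim_of => A B.
  rewrite -lecR; apply: le_trans (norm_entry_le_opnorm _ i j).
  by rewrite opmxB_entry -[X in `|X|%:C](raddfB (@complex.Re R)) normc_ge_Re.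
have /choice[im imP] : forall ij : 'I_n * 'I_n, exists l, forall e : R, 0 < e ->
    \forall A \near F, `|l - fIm ij A| < e.
  move=> [i j]; apply: lim_of => A B.
  rewrite -lecR; apply: le_trans (norm_entry_le_opnorm _ i j).
  by rewrite opmxB_entry -[X in `|X|%:C](raddfB (@complex.Im R)) normc_ge_Im.
pose L : opmx R n := \matrix_(i, j) (re (i, j) +i* im (i, j)).
apply/cvg_ex; exists L; apply/fcvgrPdist_lt => e e0.
have eE : e = (complex.Re e)%:C by apply: complex_ge0E; exact: ltW.
(* There are n^2 entries, each with a real and an imaginary error below e / N; the added 1 makes the
   total strictly less than e, also for n = 0. *)
pose N : R := (n * n)%:R * 2 + 1.
have N0 : 0 < N by rewrite ltr_wpDl// mulr_ge0.
have d0 : 0 < complex.Re e / N by rewrite divr_gt0// -ltcR -eE.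
have near_re : \forall A \near F, forall ij : 'I_n * 'I_n,
    `|re ij - fRe ij A| < complex.Re e / N.
  by apply: filter_forall => ij; exact: reP.
have near_im : \forall A \near F, forall ij : 'I_n * 'I_n,
    `|im ij - fIm ij A| < complex.Re e / N.
  by apply: filter_forall => ij; exact: imP.
apply: filterS2 near_re near_im => A reA imA.
rewrite opmx_normE (le_lt_trans (opnorm_le_sum _))//.
apply: (@le_lt_trans _ _ (\sum_(i < n) \sum_(j < n) (complex.Re e / N * 2)%:C)).
  apply: ler_sum => i _; apply: ler_sum => j _.
  rewrite opmxB_entry (le_trans (normc_le_ReIm _))// lecR mulr_natr mulr2n.
  rewrite mxE (raddfB (@complex.Re R)) (raddfB (@complex.Im R)).
  by rewrite lerD// ltW//; [exact: (reA (i, j))|exact: (imA (i, j))].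
rewrite !sumr_const !card_ord -mulrnA -rmorphMn/= eE ltcR.
have -> : complex.Re e / N * 2 *+ (n * n) =
    complex.Re e * (((n * n)%:R * 2) / N).
  rewrite -[LHS]mulr_natr -!mulrA; congr (_ * _).
  by rewrite [LHS]mulrC [2 * _]mulrC -mulrA.
rewrite gtr_pMr; last by rewrite -ltcR -eE.
by rewrite ltr_pdivrMr// mul1r ltrDl.
Qed.

HB.instance Definition _ := Uniform_isComplete.Build (opmx R n) opmx_complete.

Let opmx_mul (A B : opmx R n) : opmx R n := A *m B.
Let opmx_star (A : opmx R n) : opmx R n := A^t*.
Let opmx_mulA : associative opmx_mul. Proof. exact: mulmxA. Qed.
Let opmx_mul_linearl (a : R[i]) (x y z : opmx R n) :
  opmx_mul (a *: x + y) z = a *: opmx_mul x z + opmx_mul y z.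
Proof. by rewrite /opmx_mul mulmxDl scalemxAl. Qed.
Let opmx_mul_linearr (a : R[i]) (x y z : opmx R n) :
  opmx_mul x (a *: y + z) = a *: opmx_mul x y + opmx_mul x z.
Proof. by rewrite /opmx_mul mulmxDr scalemxAr. Qed.
Let opmx_star_antilinear (a : R[i]) (x y : opmx R n) :
  opmx_star (a *: x + y) = Num.conj a *: opmx_star x + opmx_star y.
Proof. by apply/matrixP => i j; rewrite !mxE rmorphD rmorphM. Qed.
Let opmx_starK : involutive opmx_star. Proof. exact: trmxCK. Qed.
Let opmx_starM (x y : opmx R n) :
  opmx_star (opmx_mul x y) = opmx_mul (opmx_star y) (opmx_star x).
Proof. by rewrite /opmx_star /opmx_mul trmx_mul map_mxM. Qed.
Let opmx_normM (x y : opmx R n) : `|opmx_mul x y| <= `|x| * `|y|.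
Proof. by rewrite !opmx_normE -rmorphM lecR opnormM. Qed.
Let opmx_norm_starM (x : opmx R n) :
  `|opmx_mul (opmx_star x) x| = `|x| ^+ 2.
Proof. by rewrite !opmx_normE opnorm_adjM rmorphXn. Qed.

HB.instance Definition _ := CompleteNormedModule_isCStarAlgebra.Build R
  (opmx R n) opmx_mulA opmx_mul_linearl opmx_mul_linearr opmx_star_antilinear
  opmx_starK opmx_starM opmx_normM opmx_norm_starM.

(** The algebra as a module over itself with <x, y> = x* y; the C*-identity makes the two norms
    agree. *)
Let opmx_inner (x y : opmx R n) : opmx R n := cmul (cstar x) y.
Let opmx_inner_linearr (a : R[i]) (x y z : opmx R n) :
  opmx_inner x (a *: y + z) = a *: opmx_inner x y + opmx_inner x z.
Proof. exact: cmul_linearr. Qed.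
Let opmx_ractA (x b c : opmx R n) : cmul (cmul x b) c = cmul x (cmul b c).
Proof. by rewrite cmulA. Qed.
Let opmx_inner_ractr (x y b : opmx R n) :
  opmx_inner x (cmul y b) = cmul (opmx_inner x y) b.
Proof. exact: cmulA. Qed.
Let opmx_inner_star (x y : opmx R n) : cstar (opmx_inner x y) = opmx_inner y x.
Proof. by rewrite /opmx_inner cstarM cstarK. Qed.
Let opmx_inner_pos (x : opmx R n) : cpositive (opmx_inner x x).
Proof. by exists x. Qed.
Let opmx_norm_inner (x : opmx R n) : `|x| ^+ 2 = `|opmx_inner x x|.
Proof. by rewrite cnorm_starM. Qed.
Let opmx_inner_definite (x : opmx R n) : opmx_inner x x = 0 -> x = 0.
Proof.
move=> x0; apply/eqP; rewrite -normr_eq0 -sqrf_eq0.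
by rewrite opmx_norm_inner x0 normr0.
Qed.

HB.instance Definition _ := CompleteNormedModule_isHilbertModule.Build R
  (opmx R n) (opmx R n) (@cmul_linearl R (opmx R n))
  (@cmul_linearr R (opmx R n)) opmx_ractA opmx_inner_linearr
  opmx_inner_ractr opmx_inner_star opmx_inner_pos opmx_inner_definite
  opmx_norm_inner.

Lemma ract_inner_opmxE (x y z : opmx R n) :
  ract x (inner y z) = x *m (y^t* *m z).
Proof. by []. Qed.

End OperatorMatrix.

(** * Counterexamples among 2 by 2 matrices *)

Section Counterexamples.
Variable R : realType.
Let M2 := opmx R 2.

(** Entries are dominated by the operator norm, so a vanishing entry survives limits. *)
Lemma closure_entry0 (K : set M2) (i j : 'I_2) :
  (forall A, K A -> A i j = 0) -> forall A, closure K A -> A i j = 0.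
Proof.
move=> K0 A /closure_rnormP KA; apply/eqP; rewrite -normr_le0.
have -> : `|A i j| = (complex.Re `|A i j|)%:C by apply: complex_ge0E.
rewrite lecR; apply/ler_addgt0Pl => e /KA[A' /K0 A'0 AA'].
rewrite addr0 (le_trans _ (ltW AA'))// -lecR -(complex_ge0E (normr_ge0 _)).
rewrite -rnormE opmx_normE -[A i j]subr0 -A'0 -opmxB_entry.
exact: norm_entry_le_opnorm.
Qed.

Let e00 : M2 := delta_mx 0 0.
Let e01 : M2 := delta_mx 0 1.
Let e10 : M2 := delta_mx 1 0.

(** [K] is the left ideal of matrices with zero second column. It contains e00, but e00 e00* e01 =
    e01 has a nonzero entry there. *)
Lemma condition_a_not_sufficient : exists K : set M2,
  [/\ linear_subspace K, condition_a K & ~ ternary_ideal (closure K)].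
Proof.
pose K : set M2 := [set A | forall i, A i 1 = 0].
exists K; split.
- split; first by rewrite inE => i; rewrite mxE.
  move=> a u v; rewrite !inE => u0 v0 i.
  by rewrite !mxE u0 v0 mulr0 addr0.
- move=> _ [x [y [z [_ _ Kz ->]]]] i.
  rewrite ract_inner_opmxE mulmxA mxE big1// => j _.
  by rewrite Kz mulr0.
- move=> [_ EKE].
  have : closure K (ract e00 (inner e00 e01)).
    apply: EKE; exists e00, e00, e01; split=> //; apply: subset_closure => i.
    by rewrite mxE andbF.
  move=> /(closure_entry0 (fun A KA => KA 0)).
  rewrite ract_inner_opmxE /e00 /e01.
  rewrite trmx_delta map_delta_mx !mul_delta_mx mxE !eqxx/= => /eqP.
  by rewrite oner_eq0.
Qed.

(** [K] is the right ideal of matrices with zero second row. It contains e00, but e10 e00* e00 = e10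
    has a nonzero entry there. *)
Lemma condition_b_not_sufficient : exists K : set M2,
  [/\ linear_subspace K, condition_b K & ~ ternary_ideal (closure K)].
Proof.
pose K : set M2 := [set A | forall j, A 1 j = 0].
exists K; split.
- split; first by rewrite inE => i; rewrite mxE.
  move=> a u v; rewrite !inE => u0 v0 i.
  by rewrite !mxE u0 v0 mulr0 addr0.
- move=> _ [x [y [z [Kx _ _ ->]]]] i.
  rewrite ract_inner_opmxE mxE big1// => j _.
  by rewrite Kx mul0r.
- move=> [_ EKE].
  have : closure K (ract e10 (inner e00 e00)).
    apply: EKE; exists e10, e00, e00; split=> //; apply: subset_closure => i.
    by rewrite mxE.
  move=> /(closure_entry0 (fun A KA => KA 0)).
  rewrite ract_inner_opmxE /e00 /e10.
  rewrite trmx_delta map_delta_mx !mul_delta_mx mxE !eqxx/= => /eqP.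
  by rewrite oner_eq0.
Qed.

End Counterexamples.

(** Conditions (a) and (b) do not produce sums: in C + C over itself, the union of the two axes
    satisfies both. Hence linearity is assumed for the full conclusion in the second part. In the
    last two parts [K] is linear, so that the product inclusion itself is what fails. *)
Theorem corollary1p1 (R : realType) :
  (forall (B : cstarAlgType R) (E : hilbertModType B) (K : set E),
      closed K -> ternary_ideal K -> condition_a K /\ condition_b K)
  /\
  (forall (B : cstarAlgType R) (E : hilbertModType B) (K : set E),
      condition_a K -> condition_b K ->
      ternary_product setT (closure K) setT `<=` closure K
      /\ (linear_subspace K -> ternary_ideal (closure K)))
  /\
  (~ (forall (B : cstarAlgType R) (E : hilbertModType B) (K : set E),
         linear_subspace K -> condition_a K -> ternary_ideal (closure K)))
  /\
  (~ (forall (B : cstarAlgType R) (E : hilbertModType B) (K : set E),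
         linear_subspace K -> condition_b K -> ternary_ideal (closure K))).
Proof.
split; first by move=> B E K Kcl [_]; exact: closed_ternary_ideal_conditions.
split.
  move=> B E K aK bK; have EKE := closure_ternary_product aK bK.
  by split=> // linK; split=> //; exact: closure_linear_subspace.
split=> H.
  have [K [linK aK]] := condition_a_not_sufficient R.
  by apply; exact: H.
have [K [linK bK]] := condition_b_not_sufficient R.
by apply; exact: H.
Qed.
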